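(* Let $\triangle ABC$ be a nondegenerate triangle circumscribed about a central conic $\mathcal{D}$, and let $\mathcal{P}$ be the family of all nondegenerate triangles inscribed in the circumcircle of $\triangle ABC$ and circumscribed about $\mathcal{D}$. Then the quantity $\sin^2 A+\sin^2 B+\sin^2 C$ (with $A,B,C$ the angles of the triangle) takes the same value for all triangles in $\mathcal{P}$ if and only if the circumcenter of $\triangle ABC$ coincides with either the center of $\mathcal{D}$ or one of its foci.
   Context: A central conic is a non-degenerate ellipse or hyperbola. A triangle is circumscribed about a conic if each of its three sidelines is tangent to the conic. *)

(* Defs.v *)
From HB Require Import structures.
From mathcomp Require Import all_boot all_order all_algebra.
From mathcomp Require Import all_classical all_reals all_analysis.
Set Implicit Arguments. Unset Strict Implicit. Unset Printing Implicit Defensive.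
Import Order.TTheory GRing.Theory Num.Theory.
Local Open Scope ring_scope.

Section Geometry.
Variable R : realType.
Definition pt := (R * R)%type.

Definition psub (p q : pt) : pt := (p.1 - q.1, p.2 - q.2).
Definition dot (p q : pt) : R := p.1 * q.1 + p.2 * q.2.
Definition cross (p q : pt) : R := p.1 * q.2 - p.2 * q.1.
Definition pnorm (p : pt) : R := Num.sqrt (dot p p).
Definition dist (p q : pt) : R := pnorm (psub p q).

Definition collinear (P Q S : pt) : Prop := cross (psub Q P) (psub S P) = 0.

Definition angle (V W1 W2 : pt) : R :=
  acos (dot (psub W1 V) (psub W2 V) / (dist W1 V * dist W2 V)).

Definition sin_sq_sum (A B C : pt) : R :=
  sin (angle A B C) ^+ 2 + sin (angle B C A) ^+ 2 + sin (angle C A B) ^+ 2.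

(* A central conic (non-degenerate ellipse or hyperbola) given in its
   canonical frame: center c, unit axis vector u (second axis u^perp),
   semi-axes a, b > 0; in coordinates x = (p-c).u, y = (p-c).u^perp it is
     ellipse:    x^2/a^2 + y^2/b^2 = 1
     hyperbola:  x^2/a^2 - y^2/b^2 = 1   (when cc_hyp = true). *)
Record central_conic := CentralConic {
  cc_center : pt;
  cc_axis : pt;
  cc_a : R;
  cc_b : R;
  cc_hyp : bool;
  cc_axis_unit : cc_axis.1 ^+ 2 + cc_axis.2 ^+ 2 = 1;
  cc_a_gt0 : 0 < cc_a;
  cc_b_gt0 : 0 < cc_b }.

Definition perp (u : pt) : pt := (- u.2, u.1).
Definition sgn_conic (D : central_conic) : R := if cc_hyp D then -1 else 1.
Definition cx (D : central_conic) (p : pt) : R := dot (psub p (cc_center D)) (cc_axis D).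
Definition cy (D : central_conic) (p : pt) : R :=
  dot (psub p (cc_center D)) (perp (cc_axis D)).

Definition on_conic (D : central_conic) (p : pt) : Prop :=
  cx D p ^+ 2 / cc_a D ^+ 2 + sgn_conic D * (cy D p ^+ 2 / cc_b D ^+ 2) = 1.

(* The line through the distinct points P, Q is tangent to D: it passes through
   a pt T of D and its direction is orthogonal to the gradient of the
   defining quadratic at T (i.e. it is the tangent line of D at T). *)
Definition tangent_line (D : central_conic) (P Q : pt) : Prop :=
  P <> Q /\ exists T : pt, on_conic D T /\ collinear P Q T /\
    cx D T * dot (psub Q P) (cc_axis D) / cc_a D ^+ 2
    + sgn_conic D * (cy D T * dot (psub Q P) (perp (cc_axis D)) / cc_b D ^+ 2) = 0.

Definition circumscribed (D : central_conic) (A B C : pt) : Prop :=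
  tangent_line D A B /\ tangent_line D B C /\ tangent_line D C A.

Definition padd (p q : pt) : pt := (p.1 + q.1, p.2 + q.2).
Definition pscale (k : R) (p : pt) : pt := (k * p.1, k * p.2).

(* Foci of D: for a hyperbola c +- sqrt(a^2+b^2) u; for an ellipse along the
   major axis, c +- sqrt(|a^2-b^2|) times the major-axis unit vector
   (both foci equal the center for a circle). *)
Definition is_focus (D : central_conic) (F : pt) : Prop :=
  let c := cc_center D in let u := cc_axis D in
  let a := cc_a D in let b := cc_b D in
  if cc_hyp D then
    exists s : R, (s = 1 \/ s = -1) /\
      F = padd c (pscale (s * Num.sqrt (a ^+ 2 + b ^+ 2)) u)
  else if b <= a then
    exists s : R, (s = 1 \/ s = -1) /\
      F = padd c (pscale (s * Num.sqrt (a ^+ 2 - b ^+ 2)) u)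
  else
    exists s : R, (s = 1 \/ s = -1) /\
      F = padd c (pscale (s * Num.sqrt (b ^+ 2 - a ^+ 2)) (perp u)).

Definition is_circumcenter (O A B C : pt) : Prop :=
  dist O A = dist O B /\ dist O A = dist O C.

(* X Y Z belongs to the family P: nondegenerate triangle inscribed in the
   circle of center O through A (the circumcircle of ABC) and
   circumscribed about D. *)
Definition in_family (D : central_conic) (O A X Y Z : pt) : Prop :=
  ~ collinear X Y Z /\ dist O X = dist O A /\ dist O Y = dist O A /\
  dist O Z = dist O A /\ circumscribed D X Y Z.

End Geometry.

(* Main.v *)
Require Import Defs.
From HB Require Import structures.
From mathcomp Require Import all_boot all_order all_algebra.
From mathcomp Require Import all_classical all_reals all_analysis.
From mathcomp Require Import complex ring lra.
Import Order.TTheory GRing.Theory Num.Theory.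
Local Open Scope ring_scope.
Set Implicit Arguments. Unset Strict Implicit. Unset Printing Implicit Defensive.

(**
Use complex coordinates in which the circumcircle is the unit circle and the
axes of the conic are parallel to the coordinate axes. Let [o] be the vector
from the center of the conic to the circumcenter, and let [c] be [a^2 - b^2]
(ellipse) or [a^2 + b^2] (hyperbola) in the rescaled plane, so that the foci
are [- o + k] and [- o - k] with [k^2 = c]. The chord [z w] of the unit circle
is tangent to the conic iff a polynomial of degree 2 in each of [z] and [w]
vanishes. Eliminating two vertices gives the closing condition of Poncelet's
porism (for triangles, the relation of Chapple and Euler) and, for every
triangle of the family,
   [z1 + z2 + z3 = - 2 o + (conj o ^ 2 - c) z1 z2 z3].
Since [4 (sin^2 A + sin^2 B + sin^2 C) = 9 - |z1 + z2 + z3|^2], the quantity is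
constant if [o = 0] (the circumcenter is the center) or [o^2 = c] (it is a
focus). Otherwise, constancy would force every vertex to be a root of a fixed
nonzero polynomial, whereas every point of the circle near a vertex of the
given triangle is a vertex of another triangle of the family.
*)

(** * Polynomials on the unit circle *)

Section Circle.
Variable C : numClosedFieldType.
Implicit Types (p : {poly C}) (z a d : C).

Lemma unit_conj {z} : `|z| = 1 -> z * z^* = 1.
Proof. by move=> z1; rewrite -normCK z1 expr1n. Qed.

Lemma unit_neq0 {z} : `|z| = 1 -> z != 0.
Proof. by move=> z1; rewrite -normr_gt0 z1. Qed.

Lemma unit_conjV {z} : `|z| = 1 -> z^* = z^-1.
Proof.
by move=> z1; apply: (mulfI (unit_neq0 z1)); rewrite unit_conj ?mulfV ?unit_neq0.
Qed.

(** Splitting off the factor ['X - a] leaves a quotient bounded on the circle by the sum of the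
    norms of its coefficients; adding 1 keeps [m] positive even for a zero quotient. This bound
    stands in for continuity at [a]. *)
Lemma poly_circle_bound p a : p.[a] = 0 ->
  exists2 m, 0 < m & forall z, `|z| = 1 -> `|p.[z]| <= m * `|z - a|.
Proof.
move=> /eqP/factor_theorem[q ->].
pose m := \sum_(i < size q) `|q`_i|.
have m0 : 0 <= m by apply: sumr_ge0 => i _.
exists (m + 1); first by rewrite ltr_wpDl.
move=> z z1; rewrite hornerM !hornerE normrM ler_wpM2r //.
rewrite horner_coef (le_trans (ler_norm_sum _ _ _))// -[X in X <= _]addr0 lerD//.
by apply: ler_sum => i _; rewrite normrM normrX z1 expr1n mulr1.
Qed.

Lemma nonroot_near_on_circle p a d : p != 0 -> `|a| = 1 -> 0 < d ->
  exists z, [/\ `|z| = 1, `|z - a| < d & p.[z] != 0].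
Proof.
move=> p0 a1 d0.
(* Rotating [a] by [u / u^*] with [u = 1 + 'i * t] moves it by [2 t / |u| <= 2 t]; the denominator
   [n + 3] makes this less than [d]. The points obtained are distinct, so [size p] of them cannot
   all be roots. *)
pose t n : C := d / n.+3%:R.
have t0 n : 0 < t n by rewrite divr_gt0// ltr0n.
have ti n : (t n)^* = t n by apply/CrealP/gtr0_real.
have t2 n : 2 * t n < d.
  rewrite /t mulrCA gtr_pMr// ltr_pdivrMr ?ltr0n// mul1r ltr_nat//.
pose u n : C := 1 + 'i * t n.
have uc n : (u n)^* = 1 - 'i * t n.
  by rewrite /u rmorphD rmorphM rmorph1/= conjCi ti mulNr.
have u1 n : 1 <= `|u n|.
  rewrite -(@ler_pXn2r _ 2) ?nnegrE// expr1n normCK uc.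
  rewrite mulrC -subr_sqr expr1n exprMn sqrCi mulN1r opprK lerDl exprn_ge0//.
  exact/ltW.
have u0 n : u n != 0 by rewrite -normr_gt0 (lt_le_trans ltr01).
have uc0 n : (u n)^* != 0 by rewrite conjC_eq0.
pose w n := a * (u n / (u n)^*).
have wi : injective w.
  move=> m n /(mulfI (unit_neq0 a1)) e.
  have : 'i * (t m - t n) = 0 :> C.
    have : u m * (u n)^* = u n * (u m)^*.
      by apply/eqP; rewrite -eqr_div// e.
    rewrite !uc /u => /eqP; rewrite -subr_eq0 => /eqP h.
    have : (2 : C) * ('i * (t m - t n)) = 0 by rewrite -h; ring.
    by move/eqP; rewrite mulf_eq0 pnatr_eq0 => /eqP.
  move/eqP; rewrite mulf_eq0 (negPf (neq0Ci C)) subr_eq0 => /eqP.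
  move/(mulfI (lt0r_neq0 d0))/invr_inj/eqP.
  by rewrite eqr_nat => /eqP[].
have w1 n : `|w n| = 1.
  by rewrite /w normrM normf_div norm_conjC a1 divff ?mulr1// normr_eq0.
have wa n : `|w n - a| < d.
  rewrite /w -[X in _ - X]mulr1 -mulrBr normrM a1 mul1r.
  have -> : u n / (u n)^* - 1 = 2 * 'i * t n / (u n)^*.
    have := uc0 n; rewrite uc => h; rewrite /u; field; exact: h.
  rewrite normf_div norm_conjC ltr_pdivrMr ?(lt_le_trans ltr01)//.
  rewrite normrM (gtr0_norm (t0 n)) normrM normCi mulr1 normr_nat.
  by rewrite (lt_le_trans (t2 n))// ler_peMr// ltW.
have [|] := boolP (all (root p) [seq w n | n <- iota 0 (size p)]).
  move=> ar; have := max_poly_roots p0 ar.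
  by rewrite map_inj_uniq// iota_uniq size_map size_iota ltnn => /(_ isT).
move=> /allPn[_ /mapP[n _ ->] nr]; exists (w n); split => //.
Qed.

End Circle.

(** * Tangent chords of the unit circle and the closing condition *)

Section Poncelet.
Variables (C : numClosedFieldType) (o c S : C).
Implicit Types z w : C.

(** The line through [z] and [w] is [x + z w x^* = z + w]; with the origin moved to the center of
    the conic, its constant term becomes [z + w + o + o^* z w]. [S] stands for the sum of the
    rescaled squared semi-axes, the second taken negatively for a hyperbola. *)
Definition chord_form z w : C :=
  (z + w + o + o^* * z * w) ^+ 2 - c * ((z * w) ^+ 2 + 1) - 2 * S * (z * w).

(** The last condition keeps the chord off the center of the conic, which excludes asymptotes. *)
Definition tangent_chord z w : Prop :=
  [/\ z != w, chord_form z w = 0 & z + w + o + o^* * z * w != 0].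

Definition poncelet_triangle z1 z2 z3 : Prop :=
  [/\ `|z1| = 1, `|z2| = 1 & `|z3| = 1] /\
  [/\ tangent_chord z1 z2, tangent_chord z2 z3 & tangent_chord z3 z1].

Definition coefA z : C := (1 + o^* * z) ^+ 2 - c * z ^+ 2.
Definition coefN z : C := 2 * S * z - 2 * (1 + o^* * z) * (z + o).
Definition coefB z : C := (z + o) ^+ 2 - c.

Lemma chord_formE z w :
  chord_form z w = coefA z * w ^+ 2 - coefN z * w + coefB z.
Proof. by rewrite /chord_form /coefA /coefN /coefB; ring. Qed.

Lemma chord_formC z w : chord_form z w = chord_form w z.
Proof. by rewrite /chord_form; ring. Qed.

Lemma tangent_chordC z w : tangent_chord z w -> tangent_chord w z.
Proof.
move=> [zw q n]; split; [by rewrite eq_sym|by rewrite chord_formC|].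
by rewrite (addrC w) mulrAC.
Qed.

(** For a circle of radius [rho] ([c = 0], [S = 2 rho^2]) its vanishing reads
    [(1 - |o|^2)^2 = 4 rho^2], the relation of Chapple and Euler. *)
Definition poncelet_defect : C :=
  (o^* ^+ 2 - c) * (o ^+ 2 - c) - 2 * o * o^* + 1 - 2 * S.

(** If [w1], [w2] are the roots of the quadratic [chord_form z], the left side is [A^2] times
    [chord_form w1 w2] and the right side is the defect times [A (z - w1) (z - w2)]: the third side
    closes up when the defect vanishes. *)
Lemma opposite_chord z :
  (coefN z + o * coefA z + o^* * coefB z) ^+ 2
    - c * (coefB z ^+ 2 + coefA z ^+ 2) - 2 * S * (coefB z * coefA z)
  = poncelet_defect * (coefA z * z ^+ 2 - coefN z * z + coefB z).
Proof. by rewrite /poncelet_defect /coefA /coefN /coefB; ring. Qed.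

(** With zero defect, division by [coefA z] turns this into the formula for the sum of the
    vertices. *)
Lemma coefN_defect z : coefN z =
  (o^* ^+ 2 - c) * z * coefB z - (2 * o + z) * coefA z - z * poncelet_defect.
Proof. by rewrite /poncelet_defect /coefA /coefN /coefB; ring. Qed.

(** Subtracting the two equations and cancelling [w1 - w2] avoids any division by [coefA z], which
    is not yet known to be nonzero. *)
Lemma chord_vieta {z w1 w2} : w1 != w2 ->
  chord_form z w1 = 0 -> chord_form z w2 = 0 ->
  coefA z * (w1 + w2) = coefN z /\ coefA z * (w1 * w2) = coefB z.
Proof.
rewrite -subr_eq0 !chord_formE => w12 h1 h2.
have eN : coefA z * (w1 + w2) = coefN z.
  apply/eqP; rewrite -subr_eq0; apply/eqP/(mulfI w12); rewrite mulr0.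
  by rewrite -[RHS](subrr 0) -{1}h1 -h2; ring.
split=> //; apply/eqP; rewrite -subr_eq0 -[X in _ == X]oppr0 -h1 -eN.
by apply/eqP; ring.
Qed.

Hypotheses (c_real : c^* = c) (S_real : S^* = S) (cS : c ^+ 2 != S ^+ 2).

(** Since [z^* = z^-1], the conjugate of [1 + o^* z] is [(z + o) / z]. Conjugation thus exchanges
    the outer coefficients up to [z^2]: the quadratic is self-inversive. *)
Lemma coefA_conj z : `|z| = 1 -> (coefA z)^* = coefB z / z ^+ 2.
Proof.
move=> z1; have z0 := unit_neq0 z1; rewrite /coefA /coefB.
rewrite rmorphB rmorphXn rmorphM rmorphXn rmorphD rmorphM rmorph1 /= c_real conjCK.
by rewrite (unit_conjV z1); field.
Qed.

Lemma coefN_conj z : `|z| = 1 -> (coefN z)^* = coefN z / z ^+ 2.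
Proof.
move=> z1; have z0 := unit_neq0 z1; rewrite /coefN.
rewrite rmorphB !rmorphM !rmorphD !rmorphM rmorph1 /= S_real conjCK.
by rewrite (unit_conjV z1); field.
Qed.

Lemma coefB_conj z : `|z| = 1 -> (coefB z)^* = coefA z / z ^+ 2.
Proof.
move=> z1; have z0 := unit_neq0 z1; rewrite /coefA /coefB.
rewrite rmorphB rmorphXn rmorphD /= c_real.
by rewrite (unit_conjV z1); field.
Qed.

Lemma coefB_eq0 z : `|z| = 1 -> coefA z = 0 -> coefB z = 0.
Proof.
move=> z1 A0; have := coefA_conj z1; rewrite A0 rmorph0 => /esym/eqP.
by rewrite mulf_eq0 invr_eq0 expf_eq0/= (negPf (unit_neq0 z1)) orbF => /eqP.
Qed.

(** If all coefficients vanished, squaring [S z = (1 + o^* z) (z + o)] would give [S^2 = c^2], that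
    is, a degenerate conic. *)
Lemma coefAN_neq0 z : `|z| = 1 -> coefN z = 0 -> coefA z != 0.
Proof.
move=> z1 N0; apply: contra cS => /eqP A0; have z0 := unit_neq0 z1.
have B0 := coefB_eq0 z1 A0.
move/eqP: A0; rewrite subr_eq0 => /eqP A0.
move/eqP: B0; rewrite subr_eq0 => /eqP B0.
move/eqP: N0; rewrite subr_eq0 -!mulrA (inj_eq (mulfI _)) ?pnatr_eq0//.
move=> /eqP N0.
apply/eqP/(mulIf (expf_neq0 2 z0)); rewrite -[RHS]exprMn N0 exprMn A0 B0.
by ring.
Qed.

Lemma poncelet_triangle_defect z1 z2 z3 :
  poncelet_triangle z1 z2 z3 -> poncelet_defect = 0.
Proof.
move=> [[u1 u2 u3] [[n12 q12 _] [n23 q23 _] [n31 q31 _]]].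
rewrite chord_formC in q23.
have [eN eB] := chord_vieta n12 q31 q23.
have A0 : coefA z3 != 0.
  apply/negP => /eqP A0; have := @coefAN_neq0 z3 u3.
  by rewrite -eN A0 mul0r eqxx => /(_ erefl).
have := opposite_chord z3; rewrite -eN -eB.
have -> :
    (coefA z3 * (z1 + z2) + o * coefA z3 + o^* * (coefA z3 * (z1 * z2))) ^+ 2
    - c * ((coefA z3 * (z1 * z2)) ^+ 2 + coefA z3 ^+ 2)
    - 2 * S * (coefA z3 * (z1 * z2) * coefA z3) = coefA z3 ^+ 2 * chord_form z1 z2.
  by rewrite /chord_form; ring.
have -> : coefA z3 * z3 ^+ 2 - coefA z3 * (z1 + z2) * z3 + coefA z3 * (z1 * z2)
  = coefA z3 * (z3 - z1) * (z3 - z2) by ring.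
rewrite q12 mulr0 => /esym/eqP; rewrite mulf_eq0 => /orP[/eqP//|].
by rewrite !mulf_eq0 (negPf A0) !subr_eq0 (negPf n31) eq_sym (negPf n23).
Qed.

(** * The family of triangles under the closing condition *)

Section Closing.
Hypothesis defect0 : poncelet_defect = 0.

Lemma coefA_neq0 z : `|z| = 1 -> coefA z != 0.
Proof.
move=> z1; apply/negP => /eqP A0; have := @coefAN_neq0 z z1.
have B0 := coefB_eq0 z1 A0.
by rewrite coefN_defect A0 B0 defect0 !mulr0 !subr0 eqxx => /(_ erefl).
Qed.

Lemma poncelet_triangle_sum z1 z2 z3 : poncelet_triangle z1 z2 z3 ->
  z1 + z2 + z3 = (o^* ^+ 2 - c) * (z1 * z2 * z3) - 2 * o.
Proof.
move=> [[u1 u2 u3] [[n12 q12 _] [n23 q23 _] [n31 q31 _]]].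
rewrite chord_formC in q23.
have [eN eB] := chord_vieta n12 q31 q23.
apply: (mulfI (coefA_neq0 u3)).
have := coefN_defect z3; rewrite defect0 mulr0 subr0 -eB -eN => e.
rewrite (addrC (z1 + z2)) mulrDr e; ring.
Qed.

Lemma poncelet_triangle_norm_sum z1 z2 z3 : poncelet_triangle z1 z2 z3 ->
  let w := o * (o ^+ 2 - c) in let l := z1 * z2 * z3 in
  `|z1 + z2 + z3| ^+ 2 =
  4 * `|o| ^+ 2 + `|o ^+ 2 - c| ^+ 2 - 2 * (w^* * l + w * l^-1).
Proof.
move=> t w l; have [[u1 u2 u3] _] := t.
have l1 : `|l| = 1 by rewrite !normrM u1 u2 u3 !mul1r.
have l0 := unit_neq0 l1.
rewrite (poncelet_triangle_sum t) -/l /w; clearbody l; rewrite !normCK.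
rewrite !(rmorphB, rmorphM, rmorphXn)/= !conjCK rmorph_nat c_real (unit_conjV l1).
by field.
Qed.

Lemma norm_sum_const z1 z2 z3 : o * (o ^+ 2 - c) = 0 ->
  poncelet_triangle z1 z2 z3 ->
  `|z1 + z2 + z3| ^+ 2 = 4 * `|o| ^+ 2 + `|o ^+ 2 - c| ^+ 2.
Proof.
by move=> w0 /poncelet_triangle_norm_sum/= ->; rewrite w0 rmorph0 !mul0r addr0 mulr0 subr0.
Qed.

(** In terms of the roots [w1], [w2] at [z], the four expressions are [- A^2 (w1 - w2)^2],
    [A (z - w1) (z - w2)], [A] times the constant term of the line [w1 w2], and [A] times the
    product of those of the two sides through [z]. Written in the coefficients, they are polynomials
    in [z]. *)
Definition apex_disc z : C := 4 * (coefA z * coefB z) - coefN z ^+ 2.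
Definition apex_sep z : C := coefA z * z ^+ 2 - coefN z * z + coefB z.
Definition opposite_offset z : C := coefN z + o * coefA z + o^* * coefB z.
Definition sides_offset z : C := coefA z * (z + o) ^+ 2
  + (z + o) * (1 + o^* * z) * coefN z + (1 + o^* * z) ^+ 2 * coefB z.

Definition apex z : Prop := [/\ `|z| = 1, 0 < apex_disc z / z ^+ 2
  & [/\ apex_sep z != 0, opposite_offset z != 0 & sides_offset z != 0]].

Lemma poncelet_triangle_apex z1 z2 z3 : poncelet_triangle z1 z2 z3 -> apex z3.
Proof.
move=> [[u1 u2 u3] [[n12 q12 a12] [n23 q23 a23] [n31 q31 a31]]].
rewrite chord_formC in q23.
have [eN eB] := chord_vieta n12 q31 q23.
have A0 := coefA_neq0 u3.
have [z10 z20 z30] := And3 (unit_neq0 u1) (unit_neq0 u2) (unit_neq0 u3).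
have eA : (coefA z3)^* = coefA z3 * (z1 * z2) / z3 ^+ 2 by rewrite eB coefA_conj.
split=> //.
- have -> : apex_disc z3 / z3 ^+ 2 = `|coefA z3| ^+ 2 * `|z1 - z2| ^+ 2.
    rewrite /apex_disc -eB -eN !normCK eA rmorphB/= (unit_conjV u1) (unit_conjV u2).
    by field; rewrite z10 z20 z30.
  by rewrite mulr_gt0// exprn_gt0// normr_gt0// subr_eq0.
- split.
  + have -> : apex_sep z3 = coefA z3 * ((z3 - z1) * (z3 - z2)).
      by rewrite /apex_sep -eB -eN; ring.
    by rewrite !mulf_neq0// subr_eq0// eq_sym.
  + have -> : opposite_offset z3 = coefA z3 * (z1 + z2 + o + o^* * z1 * z2).
      by rewrite /opposite_offset -eB -eN; ring.
    by rewrite mulf_neq0.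
  + have -> : sides_offset z3 = coefA z3 *
        ((z3 + z1 + o + o^* * z3 * z1) * (z2 + z3 + o + o^* * z2 * z3)).
      by rewrite /sides_offset -eB -eN; ring.
    by rewrite !mulf_neq0.
Qed.

Lemma apex_disc_conj z : `|z| = 1 -> (apex_disc z / z ^+ 2)^* = apex_disc z / z ^+ 2.
Proof.
move=> z1; have z0 := unit_neq0 z1.
rewrite rmorphM fmorphV rmorphXn rmorphB rmorphXn !rmorphM/= rmorph_nat.
rewrite coefA_conj// coefB_conj// coefN_conj// (unit_conjV z1) /apex_disc.
by field.
Qed.

(* A monic quadratic whose roots are exchanged by inversion in the circle has
   its roots on the circle exactly when its discriminant, divided by the
   constant term, is negative. *)
Lemma self_inversive_roots s p : `|p| = 1 -> s^* = s / p -> 0 < 4 - s ^+ 2 / p ->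
  exists w1 w2, [/\ w1 + w2 = s, w1 * w2 = p, w1 != w2, `|w1| = 1 & `|w2| = 1].
Proof.
move=> p1 sc k0; have p0 := unit_neq0 p1.
set k := 4 - s ^+ 2 / p in k0.
pose d := sqrtC (s ^+ 2 - 4 * p).
have d2 : d ^+ 2 = - (k * p) by rewrite sqrtCK /k; field.
have d0 : d != 0.
  by rewrite -sqrf_eq0 d2 oppr_eq0 mulf_neq0// gt_eqF.
have kc : k^* = k by apply/CrealP/gtr0_real.
have dc : d^* = - (d / p).
  have : (p * d^*) ^+ 2 = d ^+ 2.
    rewrite exprMn -rmorphXn/= d2 rmorphN rmorphM/= kc (unit_conjV p1).
    by field.
  (* The sign [p * d^* = d] is impossible: it would give [|d|^2 = - k < 0]. *)
  move/eqP; rewrite eqf_sqr => /orP[|] /eqP e.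
    have : 0 < d * d^* by rewrite -normCK exprn_gt0// normr_gt0.
    have -> : d * d^* = - k.
      by apply: (mulfI p0); rewrite mulrCA e -expr2 d2; ring.
    by rewrite oppr_gt0 => /(lt_trans k0); rewrite ltxx.
  by apply: (mulfI p0); rewrite e; field.
have norm_root e : e ^+ 2 = d ^+ 2 -> e^* = - (e / p) -> `|(s + e) / 2| = 1.
  move=> e2 ec; apply/eqP; rewrite -sqrp_eq1// normCK.
  rewrite rmorphM fmorphV rmorphD rmorph_nat/= sc ec.
  have -> : (s + e) / 2 * ((s / p - e / p) / 2) = (s ^+ 2 - e ^+ 2) / (4 * p).
    by field; rewrite p0.
  rewrite e2 d2 /k; apply/eqP; field; rewrite p0; exact: isT.
exists ((s + d) / 2), ((s - d) / 2); split.
- by field.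
- have -> : (s + d) / 2 * ((s - d) / 2) = (s ^+ 2 - d ^+ 2) / 4 by field.
  by rewrite d2 /k; field.
- rewrite -subr_eq0 (_ : _ - _ = d)//; by field.
- exact: norm_root.
- apply: norm_root; first by rewrite sqrrN.
  by rewrite rmorphN/= dc; ring.
Qed.

(** Poncelet's porism, converse to [poncelet_triangle_apex]: the two tangents from [z] meet the
    circle again at the roots of the self-inversive quadratic, and zero defect makes the third side
    tangent. *)
Lemma apex_poncelet_triangle z : apex z ->
  exists w1 w2, poncelet_triangle w1 w2 z /\ coefA z * (w1 * w2) = coefB z.
Proof.
move=> [z1 disc [sep opp sides]].
have z0 := unit_neq0 z1; have A0 := coefA_neq0 z1.
have B0 : coefB z != 0.
  rewrite -(inj_eq (mulIf (invr_neq0 (expf_neq0 2 z0)))) mul0r.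
  by rewrite -coefA_conj// conjC_eq0.
pose s := coefN z / coefA z; pose p := coefB z / coefA z.
have p1 : `|p| = 1.
  apply/eqP; rewrite -sqrp_eq1// normCK /p.
  rewrite rmorphM fmorphV/= coefA_conj// coefB_conj//.
  by apply/eqP; field; rewrite ?B0 z0 A0.
have sc : s^* = s / p.
  rewrite /s /p rmorphM fmorphV/= coefA_conj// coefN_conj//.
  by field; rewrite ?B0 z0 A0.
have k0 : 0 < 4 - s ^+ 2 / p.
  have -> : 4 - s ^+ 2 / p = (apex_disc z / z ^+ 2) / `|coefA z| ^+ 2.
    rewrite normCK coefA_conj// /s /p /apex_disc.
    by field; rewrite ?B0 z0 A0.
  by rewrite divr_gt0// exprn_gt0// normr_gt0.
have [w1 [w2 [ws wp w12 u1 u2]]] := self_inversive_roots p1 sc k0.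
have eN : coefN z = coefA z * (w1 + w2) by rewrite ws /s mulrC divfK.
have eB : coefB z = coefA z * (w1 * w2) by rewrite wp /p mulrC divfK.
exists w1, w2; split=> //; split=> //.
have q1 : chord_form z w1 = 0 by rewrite chord_formE eN eB; ring.
have q2 : chord_form z w2 = 0 by rewrite chord_formE eN eB; ring.
have : (z - w1) * (z - w2) != 0.
  apply: contra sep => /eqP e; rewrite /apex_sep eN eB.
  by rewrite -(mulr0 (coefA z)) -e; apply/eqP; ring.
rewrite mulf_eq0 negb_or !subr_eq0 => /andP[zw1 zw2].
have : (z + w1 + o + o^* * z * w1) * (z + w2 + o + o^* * z * w2) != 0.
  apply: contra sides => /eqP e; rewrite /sides_offset eN eB.
  by rewrite -(mulr0 (coefA z)) -e; apply/eqP; ring.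
rewrite mulf_eq0 negb_or => /andP[az1 az2].
split; [split=> //|exact: tangent_chordC|by []].
- apply: (mulfI (expf_neq0 2 A0)); rewrite mulr0.
  rewrite -[RHS](mul0r (apex_sep z)) -defect0 -opposite_chord eN eB.
  by rewrite /chord_form; ring.
- apply: contra opp => /eqP e; rewrite /opposite_offset eN eB.
  by rewrite -(mulr0 (coefA z)) -e; apply/eqP; ring.
Qed.

Definition polyA : {poly C} := (1 + (o^*)%:P * 'X) ^+ 2 - c%:P * 'X ^+ 2.
Definition polyN : {poly C} :=
  (2 * S)%:P * 'X - 2%:P * (1 + (o^*)%:P * 'X) * ('X + o%:P).
Definition polyB : {poly C} := ('X + o%:P) ^+ 2 - c%:P.

Lemma polyAE z : polyA.[z] = coefA z.
Proof. by rewrite /polyA /coefA !hornerE /=; ring. Qed.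

Lemma polyNE z : polyN.[z] = coefN z.
Proof. by rewrite /polyN /coefN !hornerE /=; ring. Qed.

Lemma polyBE z : polyB.[z] = coefB z.
Proof. by rewrite /polyB /coefB !hornerE /=; ring. Qed.

(** The difference of the real quotients at [z] and [a] is, up to a unit factor, a polynomial
    vanishing at [a], so [poly_circle_bound] keeps it below [h] when [|z - a| < h / m]. *)
Lemma apex_disc_gt0_near a : `|a| = 1 -> 0 < apex_disc a / a ^+ 2 ->
  exists2 d, 0 < d & forall z, `|z| = 1 -> `|z - a| < d ->
    0 < apex_disc z / z ^+ 2.
Proof.
move=> a1; set h := apex_disc a / a ^+ 2 => h0; have a0 := unit_neq0 a1.
pose q := 4%:P * (polyA * polyB) - polyN ^+ 2 - h%:P * 'X ^+ 2.
have qE z : q.[z] = apex_disc z - h * z ^+ 2.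
  by rewrite /q !(polyAE, polyBE, polyNE, hornerE)/= /apex_disc /coefA /coefB /coefN; ring.
have [|m m0 qm] := @poly_circle_bound _ q a.
  by rewrite qE /h; field.
exists (h / m) => [|z z1 za]; first exact: divr_gt0.
have z0 := unit_neq0 z1.
have zr : apex_disc z / z ^+ 2 - h \is Num.real.
  by rewrite rpredB ?(gtr0_real h0)//; apply/CrealP; exact: apex_disc_conj.
have : `|apex_disc z / z ^+ 2 - h| < h.
  have -> : apex_disc z / z ^+ 2 - h = q.[z] / z ^+ 2 by rewrite qE; field.
  rewrite normf_div normrX z1 expr1n divr1 (le_lt_trans (qm _ z1))//.
  by rewrite mulrC -ltr_pdivlMr.
by rewrite real_ltr_distl// subrr => /andP[].
Qed.

(* By [poncelet_triangle_norm_sum], a constant norm makes [l = z1 z2 z3] a root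
   of a fixed quadratic; since [l = z B(z) / A(z)] at the apex [z], every [z]
   near [z3] on the circle would be a root of a fixed polynomial of degree 6. *)
Lemma norm_sum_nonconst z1 z2 z3 K : poncelet_triangle z1 z2 z3 ->
  (forall w1 w2 w3, poncelet_triangle w1 w2 w3 -> `|w1 + w2 + w3| ^+ 2 = K) ->
  o * (o ^+ 2 - c) = 0.
Proof.
move=> t0 tK; set w := o * (o ^+ 2 - c); apply/eqP; apply: contraT => w0.
have [u3 disc [sep opp sides]] := poncelet_triangle_apex t0.
have [d d0 near_disc] := apex_disc_gt0_near u3 disc.
(* The value for which the constant norm says [w^* l^2 - k l + w = 0]; [p4] below is this quadratic
   at [l = z B / A], multiplied by [A^2]. *)
pose k := (4 * `|o| ^+ 2 + `|o ^+ 2 - c| ^+ 2 - K) / 2.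
pose p1 := polyA * 'X ^+ 2 - polyN * 'X + polyB.
pose p2 := polyN + o%:P * polyA + (o^*)%:P * polyB.
pose p3 := polyA * ('X + o%:P) ^+ 2 + ('X + o%:P) * (1 + (o^*)%:P * 'X) * polyN
  + (1 + (o^*)%:P * 'X) ^+ 2 * polyB.
pose p4 := (w^*)%:P * ('X * polyB) ^+ 2 - k%:P * ('X * polyA * polyB)
  + w%:P * polyA ^+ 2.
have p1E z : p1.[z] = apex_sep z.
  by rewrite /p1 !(polyAE, polyBE, polyNE, hornerE)/= /apex_sep /coefA /coefB /coefN; ring.
have p2E z : p2.[z] = opposite_offset z.
  by rewrite /p2 !(polyAE, polyBE, polyNE, hornerE)/= /opposite_offset /coefA /coefB /coefN; ring.
have p3E z : p3.[z] = sides_offset z.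
  by rewrite /p3 !(polyAE, polyBE, polyNE, hornerE)/= /sides_offset /coefA /coefB /coefN; ring.
have p4E z : p4.[z] =
    w^* * (z * coefB z) ^+ 2 - k * (z * coefA z * coefB z) + w * coefA z ^+ 2.
  by rewrite /p4 !(polyAE, polyBE, polyNE, hornerE)/= /coefA /coefB; ring.
have p0 : p1 * p2 * p3 * p4 != 0.
  rewrite !mulf_neq0//.
  - by apply: contra sep => /eqP e; rewrite -p1E e horner0.
  - by apply: contra opp => /eqP e; rewrite -p2E e horner0.
  - by apply: contra sides => /eqP e; rewrite -p3E e horner0.
  - apply: contra w0 => /eqP e.
    (* Since [coefA 0 = 1], the value of [p4] at 0 is [w]. *)
    have := p4E 0; rewrite e horner0 /coefA => /eqP.
    rewrite eq_sym !(mul0r, mulr0, addr0, add0r, expr0n, expr1n, subr0, oppr0).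
    by rewrite mulr1.
have [z [uz za]] := nonroot_near_on_circle p0 u3 d0.
rewrite !hornerM !mulf_eq0 !negb_or p1E p2E p3E p4E => /andP[/andP[/andP[s1 s2] s3]].
have [w1 [w2 [t e]]] : exists w1 w2, poncelet_triangle w1 w2 z /\
    coefA z * (w1 * w2) = coefB z.
  by apply: apex_poncelet_triangle; split=> //; exact: near_disc.
have [[v1 v2 _] _] := t.
have [v10 v20 z0] := And3 (unit_neq0 v1) (unit_neq0 v2) (unit_neq0 uz).
case/negP; rewrite -e.
have := poncelet_triangle_norm_sum t; rewrite (tK _ _ _ t)/= -/w => eK.
have -> : k = w^* * (w1 * w2 * z) + w * (w1 * w2 * z)^-1.
  by rewrite /k eK; field; rewrite z0 v10 v20.
by apply/eqP; field; rewrite z0 v10 v20.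
Qed.

End Closing.
End Poncelet.

(** * Coordinates along the axes of the conic and the dual equation of tangency *)

Section Frame.
Variables (R : realType) (D : central_conic R).
Implicit Types P Q T X Y Z : pt R.

Definition frame_pt (x y : R) : pt R :=
  padd (cc_center D) (padd (pscale x (cc_axis D)) (pscale y (perp (cc_axis D)))).

Lemma cx_frame x y : cx D (frame_pt x y) = x.
Proof.
have h := cc_axis_unit D; rewrite -[RHS]mulr1 -h.
by rewrite /cx /frame_pt /dot /=; ring.
Qed.

Lemma cy_frame x y : cy D (frame_pt x y) = y.
Proof.
have h := cc_axis_unit D; rewrite -[RHS]mulr1 -h.
by rewrite /cy /frame_pt /dot /=; ring.
Qed.

Lemma frame_ptK P : frame_pt (cx D P) (cy D P) = P.
Proof.
case: P => p q; have h := cc_axis_unit D.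
rewrite /frame_pt /cx /cy /dot /padd /=; move: (cc_center D) (cc_axis D) h.
move=> [c1 c2] [u1 u2] /= h; congr pair.
- transitivity (c1 + (p - c1) * (u1 ^+ 2 + u2 ^+ 2)); last by rewrite h; ring.
  by ring.
- transitivity (c2 + (q - c2) * (u1 ^+ 2 + u2 ^+ 2)); last by rewrite h; ring.
  by ring.
Qed.

Lemma frame_inj P Q : cx D P = cx D Q -> cy D P = cy D Q -> P = Q.
Proof. by move=> hx hy; rewrite -(frame_ptK P) hx hy frame_ptK. Qed.

Lemma dot_axis P Q : dot (psub P Q) (cc_axis D) = cx D P - cx D Q.
Proof. by rewrite /cx /dot /=; ring. Qed.

Lemma dot_perp P Q : dot (psub P Q) (perp (cc_axis D)) = cy D P - cy D Q.
Proof. by rewrite /cy /dot /=; ring. Qed.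

Lemma dot_frame P Q : dot (psub P Q) (psub P Q) =
  (cx D P - cx D Q) ^+ 2 + (cy D P - cy D Q) ^+ 2.
Proof.
have h := cc_axis_unit D.
rewrite -[LHS]mulr1 -h -dot_axis -dot_perp /dot /psub /perp /=; ring.
Qed.

Lemma collinear_frame P Q T : collinear P Q T <->
  (cx D Q - cx D P) * (cy D T - cy D P) = (cy D Q - cy D P) * (cx D T - cx D P).
Proof.
have h := cc_axis_unit D.
have e : cross (psub Q P) (psub T P) =
  (cx D Q - cx D P) * (cy D T - cy D P) - (cy D Q - cy D P) * (cx D T - cx D P).
  by rewrite -[LHS]mulr1 -h /cross /cx /cy /dot /psub /perp /=; ring.
rewrite /collinear e; split => [/eqP|->]; last exact: subrr.
by rewrite subr_eq0 => /eqP.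
Qed.

(* The dual equation of the conic: the line [l x + m y = n] is tangent iff
   [a^2 l^2 + sgn b^2 m^2 = n^2]; [n != 0] excludes the asymptotes. *)
Lemma tangent_lineP P Q :
  let dx := cx D Q - cx D P in let dy := cy D Q - cy D P in
  let n := cx D P * cy D Q - cy D P * cx D Q in
  tangent_line D P Q <-> [/\ P <> Q,
  cc_a D ^+ 2 * dy ^+ 2 + sgn_conic D * cc_b D ^+ 2 * dx ^+ 2 = n ^+ 2 & n != 0].
Proof.
move=> dx dy n.
have a0 := lt0r_neq0 (cc_a_gt0 D); have b0 := lt0r_neq0 (cc_b_gt0 D).
have e2 : sgn_conic D * sgn_conic D = 1 by rewrite /sgn_conic; case: ifP => _; ring.
have xn T : collinear P Q T <-> cx D T * dy - cy D T * dx = n.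
  rewrite collinear_frame -/dx -/dy /n -/dx -/dy.
  have -> : cx D P * cy D Q - cy D P * cx D Q = cx D P * dy - cy D P * dx.
    by rewrite /dx /dy; ring.
  have e : cx D T * dy - cy D T * dx - (cx D P * dy - cy D P * dx)
    = - (dx * (cy D T - cy D P) - dy * (cx D T - cx D P)) by ring.
  split=> /eqP; rewrite -subr_eq0 => /eqP h; apply/eqP; rewrite -subr_eq0.
    by rewrite e h oppr0.
  by rewrite -oppr_eq0 -e h.
split.
- move=> [PQ [T [onT [/xn]]]]; rewrite dot_axis dot_perp -/dx -/dy.
  rewrite /on_conic in onT.
  set x := cx D T in onT *; set y := cy D T in onT * => col grad.
  (* The tangent at [T] is the polar line [k X + l Y = 1]; comparison with [dy X - dx Y = n] gives
     [dy = k n] and [dx = - l n]. *)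
  pose k := x / cc_a D ^+ 2; pose l := sgn_conic D * (y / cc_b D ^+ 2).
  have ak : cc_a D ^+ 2 * k = x by rewrite /k; field.
  have bl : sgn_conic D * cc_b D ^+ 2 * l = y.
    rewrite /l; transitivity (sgn_conic D * sgn_conic D * y); first by field.
    by rewrite e2 mul1r.
  have k1 : k * x + l * y = 1 by rewrite -onT /k /l; field; rewrite a0 b0.
  have k2 : k * dx + l * dy = 0 by rewrite -grad /k /l; field; rewrite a0 b0.
  have dyE : dy = k * n.
    transitivity ((k * x + l * y) * dy); first by rewrite k1 mul1r.
    transitivity (k * (x * dy - y * dx) + y * (k * dx + l * dy)); first by ring.
    by rewrite k2 col mulr0 addr0.
  have dxE : dx = - (l * n).
    transitivity ((k * x + l * y) * dx); first by rewrite k1 mul1r.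
    transitivity (x * (k * dx + l * dy) - l * (x * dy - y * dx)); first by ring.
    by rewrite k2 col mulr0 sub0r.
  split=> //.
    transitivity (n ^+ 2 * ((cc_a D ^+ 2 * k) * k
      + (sgn_conic D * cc_b D ^+ 2 * l) * l)); first by rewrite dyE dxE; ring.
    by rewrite ak bl (mulrC x) (mulrC y) k1 mulr1.
  apply/eqP => n0; apply: PQ.
  have dx0 : dx = 0 by rewrite dxE n0 mulr0 oppr0.
  have dy0 : dy = 0 by rewrite dyE n0 mulr0.
  by apply: frame_inj; apply/esym/eqP; rewrite -subr_eq0; apply/eqP.
- move=> [PQ e n0]; split=> //.
  (* The point of contact is the pole of the line. *)
  exists (frame_pt (cc_a D ^+ 2 * dy / n) (- (sgn_conic D * cc_b D ^+ 2 * dx / n))).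
  rewrite /on_conic xn dot_axis dot_perp -/dx -/dy cx_frame cy_frame.
  split; [|split].
  + transitivity ((cc_a D ^+ 2 * dy ^+ 2
      + sgn_conic D * sgn_conic D * (sgn_conic D * cc_b D ^+ 2 * dx ^+ 2)) / n ^+ 2).
      by field; rewrite n0 a0 b0.
    by rewrite e2 mul1r e divff// expf_neq0.
  + transitivity ((cc_a D ^+ 2 * dy ^+ 2 + sgn_conic D * cc_b D ^+ 2 * dx ^+ 2) / n).
      by field.
    by rewrite e; field.
  + transitivity ((1 - sgn_conic D * sgn_conic D) * (dy * dx / n)).
      by field; rewrite n0 a0 b0.
    by rewrite e2 subrr mul0r.
Qed.

Lemma dist_sqr P Q : dist P Q ^+ 2 = dot (psub P Q) (psub P Q).
Proof. by rewrite /dist /pnorm sqr_sqrtr// /dot -!expr2 addr_ge0 ?sqr_ge0. Qed.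

Lemma dist_eq0 P Q : dist P Q = 0 -> P = Q.
Proof.
move=> d0; have := dist_sqr P Q; rewrite d0 expr0n/= /dot => /esym/eqP.
rewrite -!expr2 paddr_eq0 ?sqr_ge0// !sqrf_eq0 !subr_eq0.
by move=> /andP[/eqP e1 /eqP e2]; exact: injective_projections.
Qed.

End Frame.

(** * Angles and circumradius through cross products *)

Section Sines.
Variable R : realType.
Implicit Types O X Y Z : pt R.

Lemma distC X Y : dist X Y = dist Y X.
Proof. by rewrite /dist /pnorm /dot /=; congr Num.sqrt; ring. Qed.

(** Lagrange's identity for the dot and cross products; it also bounds the cosine quotient by 1 in
    absolute value, so [acos] is applied within its domain. *)
Lemma sin_sqr_angle X Y Z : X <> Y -> X <> Z ->
  sin (angle X Y Z) ^+ 2 =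
  cross (psub Y X) (psub Z X) ^+ 2 / (dist Y X ^+ 2 * dist Z X ^+ 2).
Proof.
move=> XY XZ; rewrite /angle.
have dist_gt0 P : P <> X -> 0 < dist P X.
  move=> PX; rewrite lt_neqAle sqrtr_ge0 andbT eq_sym.
  by apply/eqP => /dist_eq0.
have dY := dist_gt0 Y (nesym XY); have dZ := dist_gt0 Z (nesym XZ).
have key : cross (psub Y X) (psub Z X) ^+ 2 / (dist Y X ^+ 2 * dist Z X ^+ 2) =
    1 - (dot (psub Y X) (psub Z X) / (dist Y X * dist Z X)) ^+ 2.
  have -> : cross (psub Y X) (psub Z X) ^+ 2 =
      dist Y X ^+ 2 * dist Z X ^+ 2 - dot (psub Y X) (psub Z X) ^+ 2.
    by rewrite !dist_sqr /cross /dot; ring.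
  by field; rewrite !lt0r_neq0.
rewrite key; set q := dot _ _ / _.
have q1 : 0 <= 1 - q ^+ 2 by rewrite -key divr_ge0 ?sqr_ge0// mulr_ge0 ?sqr_ge0.
rewrite sin_acos ?sqr_sqrtr//.
by rewrite -ler_norml -(@expr_le1 _ 2)// real_normK ?num_real// -subr_ge0.
Qed.

Lemma circumradius_cross r O X Y Z : dist O X = r -> dist O Y = r -> dist O Z = r ->
  4 * r ^+ 2 * cross (psub Y X) (psub Z X) ^+ 2 =
  dist X Y ^+ 2 * dist Y Z ^+ 2 * dist Z X ^+ 2.
Proof.
move=> hX hY hZ.
(* Solving the linear system [2 <v, O - X> = |v|^2], [v = Y - X, Z - X], by
   Cramer's rule expresses the cross product times [O - X] through the sides. *)
pose v := psub Y X; pose w := psub Z X; pose p := psub O X.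
have pp : dot p p = r ^+ 2 by rewrite -dist_sqr hX.
have pv : 2 * dot v p = dot v v.
  have := dist_sqr O Y; rewrite hY -pp => e.
  apply/eqP; rewrite -subr_eq0 -[X in _ == X](subrr (dot p p)) {2}e.
  by apply/eqP; rewrite /v /p /dot /psub /=; ring.
have pw : 2 * dot w p = dot w w.
  have := dist_sqr O Z; rewrite hZ -pp => e.
  apply/eqP; rewrite -subr_eq0 -[X in _ == X](subrr (dot p p)) {2}e.
  by apply/eqP; rewrite /w /p /dot /psub /=; ring.
rewrite -/v -/w !dist_sqr -pp.
have -> : 4 * dot p p * cross v w ^+ 2 =
    (2 * dot v p) ^+ 2 * dot w w + (2 * dot w p) ^+ 2 * dot v v
    - 2 * (2 * dot v p) * (2 * dot w p) * dot v w.
  by rewrite /dot /cross; ring.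
by rewrite pv pw /v /w /dot /psub /=; ring.
Qed.

End Sines.

(** * The sum of squared sines through the side lengths *)

Section Sides.
Variable R : realType.

(** The law of sines: by [circumradius_cross], each squared sine is the squared opposite side over
    [4 r^2]. *)
Lemma sin_sq_sum_sides r (O X Y Z : pt R) : ~ collinear X Y Z ->
  dist O X = r -> dist O Y = r -> dist O Z = r ->
  4 * r ^+ 2 * sin_sq_sum X Y Z = dist X Y ^+ 2 + dist Y Z ^+ 2 + dist Z X ^+ 2.
Proof.
move=> ncol hX hY hZ.
have XY : X <> Y.
  by move=> e; apply: ncol; rewrite /collinear /cross /= e; ring.
have XZ : X <> Z.
  by move=> e; apply: ncol; rewrite /collinear /cross /= e; ring.
have YZ : Y <> Z.
  by move=> e; apply: ncol; rewrite /collinear /cross /= e; ring.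
have eX := circumradius_cross hX hY hZ.
have [d1 d2 d3] : [/\ dist X Y != 0, dist Y Z != 0 & dist Z X != 0].
  by split; apply/eqP => /dist_eq0 // /esym.
rewrite /sin_sq_sum sin_sqr_angle// sin_sqr_angle//; [|exact: nesym].
rewrite sin_sqr_angle//; [|exact: nesym|exact: nesym].
have -> : cross (psub Z Y) (psub X Y) = cross (psub Y X) (psub Z X).
  by rewrite /cross /=; ring.
have -> : cross (psub X Z) (psub Y Z) = cross (psub Y X) (psub Z X).
  by rewrite /cross /=; ring.
rewrite (distC Y X) (distC Z Y) (distC X Z).
have quot q : 4 * r ^+ 2 * (cross (psub Y X) (psub Z X) ^+ 2 / q) =
    dist X Y ^+ 2 * dist Y Z ^+ 2 * dist Z X ^+ 2 / q by rewrite mulrA eX.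
rewrite !mulrDr !quot.
by field; rewrite d1 d2 d3.
Qed.

Lemma circle_ncollinear r (O X Y Z : pt R) :
  dist O X = r -> dist O Y = r -> dist O Z = r ->
  X <> Y -> Y <> Z -> Z <> X -> ~ collinear X Y Z.
Proof.
move=> hX hY hZ XY YZ ZX col.
have := circumradius_cross hX hY hZ.
rewrite [cross _ _]col expr0n mulr0 => /esym/eqP; apply/negP.
by rewrite !mulf_neq0//; apply/eqP => /dist_eq0.
Qed.

End Sides.

(** * Passage from the plane to complex coordinates *)

Section Complexification.
Variables (R : realType) (D : central_conic R) (O : pt R) (r : R).
Hypothesis r0 : 0 < r.
Implicit Types P Q X Y Z : pt R.
Local Open Scope complex_scope.

(* Complex coordinates in the frame of the conic, scaled so that the circle of
   center [O] and radius [r] becomes the unit circle; [ctr] is the vector from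
   the center of the conic to [O]. *)
Definition cpt P : R[i] := (cx D P - cx D O) / r +i* ((cy D P - cy D O) / r).
Definition ctr : R[i] := cx D O / r +i* (cy D O / r).
Definition axis_diff : R[i] :=
  ((cc_a D ^+ 2 - sgn_conic D * cc_b D ^+ 2) / r ^+ 2)%:C.
Definition axis_sum : R[i] :=
  ((cc_a D ^+ 2 + sgn_conic D * cc_b D ^+ 2) / r ^+ 2)%:C.

Lemma cpt_norm_sub P Q : `|cpt P - cpt Q| ^+ 2 = (dist P Q ^+ 2 / r ^+ 2)%:C.
Proof.
rewrite -add_Re2_Im2 dist_sqr (dot_frame D) /=; congr (_%:C).
by field; exact: lt0r_neq0.
Qed.

Lemma cpt_center : cpt O = 0.
Proof. by rewrite /cpt !subrr !mul0r. Qed.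

Lemma cpt_unit P : `|cpt P| = 1 <-> dist O P = r.
Proof.
have e : `|cpt P| ^+ 2 = (dist O P ^+ 2 / r ^+ 2)%:C.
  by rewrite distC -cpt_norm_sub cpt_center subr0.
have r2 : r ^+ 2 != 0 by rewrite expf_neq0 ?lt0r_neq0.
split=> [h|h].
  move: e; rewrite h expr1n => -[] /esym/(canRL (divfK r2)); rewrite mul1r => h2.
  by apply/eqP; rewrite -(@eqrXn2 _ 2) ?h2 ?sqrtr_ge0 ?ltW.
by apply/eqP; rewrite -sqrp_eq1// e h divff.
Qed.

Lemma cpt_inj P Q : cpt P = cpt Q -> P = Q.
Proof.
have rV : r^-1 != 0 by rewrite invr_eq0 lt0r_neq0.
by case=> /(mulIf rV)/addIr hx /(mulIf rV)/addIr hy; exact: frame_inj hx hy.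
Qed.

Lemma cpt_surj (z : R[i]) : exists P, cpt P = z.
Proof.
case: z => x y; exists (frame_pt D (x * r + cx D O) (y * r + cy D O)).
by rewrite /cpt cx_frame cy_frame !addrK !mulfK ?lt0r_neq0.
Qed.

(** With conjugates replaced by inverses, [dx], [dy] and [n] become rational in [z] and [w]; the
    dual equation is then a nonzero multiple of [chord_form], and [n] one of the constant term of
    the chord. *)
Lemma tangent_cpt P Q : `|cpt P| = 1 -> `|cpt Q| = 1 ->
  tangent_line D P Q <-> tangent_chord ctr axis_diff axis_sum (cpt P) (cpt Q).
Proof.
set z := cpt P; set w := cpt Q => z1 w1.
have [z0 w0] := (unit_neq0 z1, unit_neq0 w1).
have rn := lt0r_neq0 r0; have i2 := sqr_i R.
pose dx := cx D Q - cx D P; pose dy := cy D Q - cy D P.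
pose n := cx D P * cy D Q - cy D P * cx D Q.
have wz : (w - z)^*%R = w^-1 - z^-1.
  by rewrite rmorphB/= (unit_conjV z1) (unit_conjV w1).
have dxE : (dx / r)%:C = ((w - z) + (w^-1 - z^-1)) / 2.
  rewrite -wz -ReJ_add; congr (_%:C); rewrite /= /dx; by field.
have dyE : (dy / r)%:C = ((w^-1 - z^-1) - (w - z)) / 2 * 'i.
  rewrite -wz -ImJ_sub; congr (_%:C); rewrite /= /dy; by field.
have nE : (n / r ^+ 2)%:C =
    ((z + ctr) * (w^-1 + ctr^*%R) - (z^-1 + ctr^*%R) * (w + ctr)) / 2 * 'i.
  have -> : (n / r ^+ 2)%:C = (complex.Im ((z + ctr)^*%R * (w + ctr)))%:C.
    congr (_%:C); rewrite /= /n; by field.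
  rewrite ImJ_sub; congr (_ / _ * _).
  rewrite -[conjc _]/(Num.conj ((z + ctr)^*%R * (w + ctr))) rmorphM/= conjCK.
  by rewrite !rmorphD/= (unit_conjV z1) (unit_conjV w1).
have nE' : (n / r ^+ 2)%:C =
    (z - w) * (z + w + ctr + ctr^*%R * z * w) / (2 * z * w) * 'i.
  by rewrite nE; congr (_ * _); field; rewrite w0 z0.
rewrite tangent_lineP -/dx -/dy -/n.
have fE : ((cc_a D ^+ 2 * dy ^+ 2 + sgn_conic D * cc_b D ^+ 2 * dx ^+ 2 - n ^+ 2)
    / r ^+ 4)%:C = (w - z) ^+ 2 / (4 * (z * w) ^+ 2) *
      chord_form ctr axis_diff axis_sum z w.
  have -> : (cc_a D ^+ 2 * dy ^+ 2 + sgn_conic D * cc_b D ^+ 2 * dx ^+ 2 - n ^+ 2)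
      / r ^+ 4 = (cc_a D ^+ 2 / r ^+ 2) * (dy / r) ^+ 2
        + (sgn_conic D * cc_b D ^+ 2 / r ^+ 2) * (dx / r) ^+ 2
        - (n / r ^+ 2) ^+ 2 by field.
  have sumE : axis_sum = (cc_a D ^+ 2 / r ^+ 2)%:C
      + (sgn_conic D * cc_b D ^+ 2 / r ^+ 2)%:C.
    by rewrite /axis_sum mulrDl rmorphD.
  have diffE : axis_diff = (cc_a D ^+ 2 / r ^+ 2)%:C
      - (sgn_conic D * cc_b D ^+ 2 / r ^+ 2)%:C.
    by rewrite /axis_diff mulrBl rmorphB.
  rewrite /chord_form sumE diffE.
  set al := cc_a D ^+ 2 / r ^+ 2; set be := sgn_conic D * cc_b D ^+ 2 / r ^+ 2.
  rewrite rmorphB rmorphD (rmorphM _ al) (rmorphM _ be) !(rmorphXn _ 2)/=.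
  rewrite dyE dxE nE' !(exprMn 2 _ 'i) i2.
  by field; rewrite w0 z0.
have PQ : P <> Q <-> z != w.
  split; first by move=> h; apply/eqP => /cpt_inj.
  by move=> /eqP zw e; apply: zw; rewrite /z /w e.
have inj0 (x : R) : x%:C = 0 <-> x = 0.
  by split=> [|->]//; case.
split=> [[pq e n0]|[zw q off]].
- have zw : z != w by apply/PQ.
  split=> //.
    have wz0 : (w - z) ^+ 2 / (4 * (z * w) ^+ 2) != 0.
      apply: mulf_neq0; first by rewrite expf_neq0// subr_eq0 eq_sym.
      rewrite invr_eq0; apply: mulf_neq0; first by rewrite pnatr_eq0.
      by rewrite expf_neq0// mulf_neq0.
    apply: (mulfI wz0); rewrite -fE mulr0 e subrr mul0r; exact/inj0.
  apply/eqP => off0; move/eqP: n0; apply.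
  have : (n / r ^+ 2)%:C = 0 by rewrite nE' off0 mulr0 !mul0r.
  by move/inj0/eqP; rewrite mulf_eq0 invr_eq0 expf_eq0 (negPf rn) orbF => /eqP.
- split; first exact/PQ.
    have : ((cc_a D ^+ 2 * dy ^+ 2 + sgn_conic D * cc_b D ^+ 2 * dx ^+ 2 - n ^+ 2)
      / r ^+ 4)%:C = 0 by rewrite fE q mulr0.
    move/inj0/eqP; rewrite mulf_eq0 invr_eq0 expf_eq0 (negPf rn) orbF subr_eq0.
    by move/eqP.
  apply/eqP => n0; move/eqP: off; apply.
  have i0 : 'i != 0 :> R[i] by rewrite -sqrf_eq0 i2 oppr_eq0 oner_eq0.
  move/eqP: nE'; rewrite n0 mul0r eq_sym !mulf_eq0 (negPf i0) invr_eq0 !mulf_eq0.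
  rewrite (negPf z0) (negPf w0) pnatr_eq0 subr_eq0 (negPf zw) !orbF => /eqP.
  exact.
Qed.

End Complexification.

(** * Center and foci in the frame of the conic *)

Section Foci.
Variables (R : realType) (D : central_conic R).
Implicit Types O : pt R.

Lemma frame_pt_axis x : frame_pt D x 0 = padd (cc_center D) (pscale x (cc_axis D)).
Proof. by rewrite /frame_pt /padd /=; congr pair; ring. Qed.

Lemma frame_pt_perp y :
  frame_pt D 0 y = padd (cc_center D) (pscale y (perp (cc_axis D))).
Proof. by rewrite /frame_pt /padd /=; congr pair; ring. Qed.

Lemma sqr_eq_pm_sqrt (x t : R) : 0 <= t ->
  x ^+ 2 = t <-> exists s, (s = 1 \/ s = -1) /\ x = s * Num.sqrt t.
Proof.
move=> t0; split.
  move=> /eqP; rewrite -{1}(sqr_sqrtr t0) eqf_sqr => /orP[] /eqP ->.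
    by exists 1; rewrite mul1r; split; [left|].
  by exists (-1); rewrite mulN1r; split; [right|].
by move=> [s [[->|->] ->]]; rewrite ?mul1r ?mulN1r ?sqrrN sqr_sqrtr.
Qed.

Lemma center_frame O : O = cc_center D <-> cx D O = 0 /\ cy D O = 0.
Proof.
have c0 : frame_pt D 0 0 = cc_center D.
  rewrite /frame_pt /padd /=; case: (cc_center D) => c1 c2 /=; congr pair; ring.
split=> [->|[hx hy]]; last by rewrite -(frame_ptK D O) hx hy c0.
by rewrite -c0 cx_frame cy_frame.
Qed.

(** The real and imaginary parts of [o^2 = c], before rescaling; this single form covers every case
    of [is_focus]. *)
Lemma focus_frame O : is_focus D O <->
  cx D O ^+ 2 - cy D O ^+ 2 = cc_a D ^+ 2 - sgn_conic D * cc_b D ^+ 2 /\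
  cx D O * cy D O = 0.
Proof.
have a0 := cc_a_gt0 D; have b0 := cc_b_gt0 D.
have on_axis t : 0 <= t -> (cy D O = 0 /\ cx D O ^+ 2 = t) <->
    exists s, (s = 1 \/ s = -1) /\
      O = padd (cc_center D) (pscale (s * Num.sqrt t) (cc_axis D)).
  move=> t0; split.
    move=> [y0 /(sqr_eq_pm_sqrt _ t0)[s [s1 x]]]; exists s; split=> //.
    by rewrite -frame_pt_axis -x -y0 frame_ptK.
  move=> [s [s1 e]]; rewrite e -frame_pt_axis cx_frame cy_frame; split=> //.
  by apply/(sqr_eq_pm_sqrt _ t0); exists s.
have on_perp t : 0 <= t -> (cx D O = 0 /\ cy D O ^+ 2 = t) <->
    exists s, (s = 1 \/ s = -1) /\
      O = padd (cc_center D) (pscale (s * Num.sqrt t) (perp (cc_axis D))).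
  move=> t0; split.
    move=> [x0 /(sqr_eq_pm_sqrt _ t0)[s [s1 y]]]; exists s; split=> //.
    by rewrite -frame_pt_perp -y -x0 frame_ptK.
  move=> [s [s1 e]]; rewrite e -frame_pt_perp cx_frame cy_frame; split=> //.
  by apply/(sqr_eq_pm_sqrt _ t0); exists s.
(* One coordinate vanishes, and the sign of [t] tells which. *)
have solve (x y t : R) : 0 <= t ->
    (x ^+ 2 - y ^+ 2 = t /\ x * y = 0) <-> (y = 0 /\ x ^+ 2 = t).
  move=> t0; split=> [[e /eqP]|[-> <-]]; last by rewrite expr0n subr0 mulr0.
  rewrite mulf_eq0 => /orP[] /eqP z0; last by move: e; rewrite z0 expr0n subr0.
  have y0 : y = 0.
    apply/eqP; rewrite -sqrf_eq0 eq_le sqr_ge0 andbT -oppr_ge0.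
    by move: t0; rewrite -e z0 expr0n sub0r.
  by rewrite -e y0 expr0n subr0.
rewrite /is_focus /sgn_conic; case: ifP => _ /=.
  rewrite -on_axis ?addr_ge0 ?sqr_ge0// -solve ?addr_ge0 ?sqr_ge0//.
  by rewrite mulN1r opprK.
have sqab : (cc_b D <= cc_a D) = (0 <= cc_a D ^+ 2 - cc_b D ^+ 2).
  by rewrite subr_ge0 ler_sqr // nnegrE ltW.
rewrite mul1r; case: ifPn; rewrite sqab => ab.
  by rewrite -on_axis// -solve.
have ba : 0 <= cc_b D ^+ 2 - cc_a D ^+ 2.
  by rewrite -opprB oppr_ge0 ltW// ltNge.
(* The major axis is the second one: the coordinates swap and the difference changes sign. *)
rewrite -on_perp// -solve// mulrC; split=> -[e ->]; split=> //.
  by rewrite -opprB e opprB.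
by rewrite -opprB e opprB.
Qed.

End Foci.

(** * Dictionary between the plane statement and the complex one *)

Section Correspondence.
Variables (R : realType) (D : central_conic R) (O : pt R) (r : R).
Hypothesis r0 : 0 < r.
Implicit Types P Q X Y Z : pt R.
Local Open Scope complex_scope.
Let o := ctr D O r.
Let c := axis_diff D r.
Let S := axis_sum D r.

Lemma axis_diff_real : c^*%R = c. Proof. exact: conjc_real. Qed.

Lemma axis_sum_real : S^*%R = S. Proof. exact: conjc_real. Qed.

(** The difference is [- 4 sgn a^2 b^2 / r^4], nonzero because both semi-axes are positive. *)
Lemma axis_diff_sum_neq : c ^+ 2 != S ^+ 2.
Proof.
have [a0 b0] := (lt0r_neq0 (cc_a_gt0 D), lt0r_neq0 (cc_b_gt0 D)).
have s0 : sgn_conic D != 0.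
  by rewrite /sgn_conic; case: ifP; rewrite ?oppr_eq0 oner_eq0.
rewrite -subr_eq0 /c /S -!rmorphXn -rmorphB /=.
rewrite (_ : _ - _ = - (4 * sgn_conic D * cc_a D ^+ 2 * cc_b D ^+ 2 / r ^+ 4)).
  rewrite -[0]/((0 : R)%:C) (inj_eq (@complexI R)) oppr_eq0.
  have n4 : 4 != 0 :> R by rewrite pnatr_eq0.
  have r4 : r ^- 4 != 0 by rewrite invr_eq0 expf_neq0 ?lt0r_neq0.
  exact: mulf_neq0 (mulf_neq0 (mulf_neq0 (mulf_neq0 n4 s0) (expf_neq0 2 a0))
    (expf_neq0 2 b0)) r4.
by field; exact: lt0r_neq0.
Qed.

Lemma center_or_focus :
  O = cc_center D \/ is_focus D O <-> o * (o ^+ 2 - c) = 0.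
Proof.
have rn := lt0r_neq0 r0.
have e1 : O = cc_center D <-> o = 0.
  rewrite center_frame; split=> [[hx hy]|[/eqP hx /eqP hy]].
    by rewrite /o /ctr hx hy !mul0r.
  move: hx hy; rewrite !mulf_eq0 !invr_eq0 (negPf rn) !orbF.
  by move=> /eqP ? /eqP ?.
have e2 : is_focus D O <-> o ^+ 2 = c.
  have -> : o ^+ 2 = ((cx D O ^+ 2 - cy D O ^+ 2) / r ^+ 2)
      +i* (2 * (cx D O * cy D O) / r ^+ 2).
    by rewrite /o /ctr expr2; simpc; congr (_ +i* _); field.
  rewrite focus_frame /c /axis_diff; split=> [[-> ->]|].
    by rewrite mulr0 mul0r.
  have r2 : (r ^+ 2)^-1 != 0 by rewrite invr_eq0 expf_neq0.
  case=> /(mulIf r2) -> /eqP; rewrite !mulf_eq0 (negPf r2) pnatr_eq0 orbF /=.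
  by rewrite -mulf_eq0 => /eqP.
rewrite e1 e2; split=> [[->|->]|/eqP]; rewrite ?mul0r ?subrr ?mulr0//.
by rewrite mulf_eq0 subr_eq0 => /orP[] /eqP; [left|right].
Qed.

Lemma circumscribed_cpt X Y Z :
  dist O X = r -> dist O Y = r -> dist O Z = r -> circumscribed D X Y Z <->
  poncelet_triangle o c S (cpt D O r X) (cpt D O r Y) (cpt D O r Z).
Proof.
move=> /(cpt_unit D _ r0) uX /(cpt_unit D _ r0) uY /(cpt_unit D _ r0) uZ.
have tXY := tangent_cpt r0 uX uY; have tYZ := tangent_cpt r0 uY uZ.
have tZX := tangent_cpt r0 uZ uX.
split=> [[/tXY h1 [/tYZ h2 /tZX h3]]|[_ [/tXY h1 /tYZ h2 /tZX h3]]].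
  exact: (conj (And3 uX uY uZ) (And3 h1 h2 h3)).
by split; [|split].
Qed.

(** For three unit complex numbers the squared mutual distances add up to 9 minus the squared norm
    of their sum. *)
Lemma sin_sq_sum_cpt X Y Z : ~ collinear X Y Z ->
  dist O X = r -> dist O Y = r -> dist O Z = r ->
  4 * (sin_sq_sum X Y Z)%:C =
  9 - `|cpt D O r X + cpt D O r Y + cpt D O r Z| ^+ 2.
Proof.
move=> ncol hX hY hZ; have rn := lt0r_neq0 r0.
have e := sin_sq_sum_sides ncol hX hY hZ.
have -> : 4 * (sin_sq_sum X Y Z)%:C =
    `|cpt D O r X - cpt D O r Y| ^+ 2 + `|cpt D O r Y - cpt D O r Z| ^+ 2
    + `|cpt D O r Z - cpt D O r X| ^+ 2.
  rewrite !cpt_norm_sub// -!rmorphD -!mulrDl -e -[4]/(4%:R) -(rmorph_nat (real_complex R)).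
  by rewrite -rmorphM; congr (_%:C); field.
move: hX hY hZ => /(cpt_unit D _ r0) uX /(cpt_unit D _ r0) uY /(cpt_unit D _ r0) uZ.
have [nX nY nZ] := And3 (unit_neq0 uX) (unit_neq0 uY) (unit_neq0 uZ).
rewrite !normCK !rmorphD !rmorphN/= (unit_conjV uX) (unit_conjV uY) (unit_conjV uZ).
by field; rewrite nX nY nZ.
Qed.

End Correspondence.

Theorem theorem5p1 (R : realType) (D : central_conic R) (A B C O : pt R) :
  ~ collinear A B C -> circumscribed D A B C -> is_circumcenter O A B C ->
  ((forall X Y Z X' Y' Z' : pt R,
      in_family D O A X Y Z -> in_family D O A X' Y' Z' ->
      sin_sq_sum X Y Z = sin_sq_sum X' Y' Z')
   <-> (O = cc_center D \/ is_focus D O)).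
Proof.
move=> ncol circ [hB hC]; pose r := dist O A.
have r0 : 0 < r.
  rewrite lt_neqAle sqrtr_ge0 andbT eq_sym; apply/eqP => r0.
  apply: ncol; rewrite -(dist_eq0 r0) -(dist_eq0 (etrans (esym hB) r0)).
  by rewrite /collinear /cross /=; ring.
have famP X Y Z : in_family D O A X Y Z <-> [/\ ~ collinear X Y Z,
    dist O X = r, dist O Y = r, dist O Z = r & circumscribed D X Y Z].
  by split=> [[? [? [? []]]]|[]].
have tABC : in_family D O A A B C by apply/famP; split.
pose z := cpt D O r; rewrite (center_or_focus _ _ r0).
have cS := axis_diff_sum_neq D r0.
have cr := axis_diff_real D r; have Sr := axis_sum_real D r.
have tri X Y Z : in_family D O A X Y Z ->
    poncelet_triangle (ctr D O r) (axis_diff D r) (axis_sum D r) (z X) (z Y) (z Z).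
  by move=> /famP[_ hX hY hZ]; exact: (proj1 (circumscribed_cpt D r0 hX hY hZ)).
have def0 := poncelet_triangle_defect cr cS (tri _ _ _ tABC).
have sumE X Y Z : in_family D O A X Y Z ->
    4 * ((sin_sq_sum X Y Z)%:C)%C = 9 - `|z X + z Y + z Z| ^+ 2.
  by move=> /famP[nc hX hY hZ _]; exact: sin_sq_sum_cpt.
have n4 : (4 : R[i]) != 0 by rewrite pnatr_eq0.
split=> [const|w0 X Y Z X' Y' Z' f f'].
(* Each complex triangle lifts to a plane triangle of the family, nondegenerate since its vertices
   are distinct points of a circle; constancy thus carries over, with the value taken at [A B C]. *)
- apply: (norm_sum_nonconst (K := 9 - 4 * ((sin_sq_sum A B C)%:C)%C) cr Sr cS def0
    (tri _ _ _ tABC)) => w1 w2 w3 t.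
  have [[u1 u2 u3] [[n12 _ _] [n23 _ _] [n31 _ _]]] := t.
  have [X hX] := cpt_surj D O r0 w1; have [Y hY] := cpt_surj D O r0 w2.
  have [Z hZ] := cpt_surj D O r0 w3.
  have dX : dist O X = r by apply/(cpt_unit D _ r0); rewrite hX.
  have dY : dist O Y = r by apply/(cpt_unit D _ r0); rewrite hY.
  have dZ : dist O Z = r by apply/(cpt_unit D _ r0); rewrite hZ.
  have fam : in_family D O A X Y Z.
    apply/famP; split=> //; last first.
      by apply: (proj2 (circumscribed_cpt D r0 dX dY dZ)); rewrite hX hY hZ.
    apply: (circle_ncollinear dX dY dZ) => e; move/eqP: n12; move/eqP: n23;
      by move/eqP: n31; rewrite -hX -hY -hZ e.
  rewrite (const A B C X Y Z)// (sumE _ _ _ fam) /z hX hY hZ; ring.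
- apply: (@complexI R); apply: (mulfI n4); rewrite (sumE _ _ _ f) (sumE _ _ _ f').
  rewrite (norm_sum_const cr cS def0 w0 (tri _ _ _ f)).
  by rewrite (norm_sum_const cr cS def0 w0 (tri _ _ _ f')).
Qed.
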